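(* Let $\mathbb{F}$ be any field, let $\mathbf{U}_1,\mathbf{U}_2,\mathbf{U}_3$ be finite dimensional vector spaces over $\mathbb{F}$ with $\dim \mathbf{U}_i=m_i$, and let $\mathbf{u}_{1,i},\ldots,\mathbf{u}_{m_i,i}$ be a basis of $\mathbf{U}_i$ for $i=1,2,3$. Let $$\tau=\sum_{i_1=1}^{m_1}\sum_{i_2=1}^{m_2}\sum_{i_3=1}^{m_3} t_{i_1i_2i_3}\,\mathbf{u}_{i_1,1}\otimes\mathbf{u}_{i_2,2}\otimes \mathbf{u}_{i_3,3}\in \mathbf{U}_1\otimes\mathbf{U}_2\otimes\mathbf{U}_3 .$$ Fix $j\in\{1,2,3\}$ and let $\{p,q\}=\{1,2,3\}\setminus\{j\}$ with $p<q$. For $i_j=1,\ldots,m_j$ let $T_{i_j,j}:=[t_{i_1i_2i_3}]_{i_p=1,\,i_q=1}^{m_p,\,m_q}\in \mathbb{F}^{m_p\times m_q}$. Then $\mathrm{rank}\,\tau$ is the minimal dimension of a subspace of the space of $m_p\times m_q$ matrices over $\mathbb{F}$ that is spanned by rank one matrices and contains the subspace spanned by $T_{1,j},\ldots,T_{m_j,j}$.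
   Context: A rank one tensor is a tensor of the form $\mathbf{x}\otimes\mathbf{y}\otimes\mathbf{z}$ with $\mathbf{x}\in\mathbf{U}_1$, $\mathbf{y}\in\mathbf{U}_2$, $\mathbf{z}\in\mathbf{U}_3$ all nonzero. The rank of $\tau\neq \mathbf{0}$ is the minimal $k$ such that $\tau=\sum_{i=1}^k \mathbf{x}_i\otimes\mathbf{y}_i\otimes\mathbf{z}_i$ with $\mathbf{x}_i\in\mathbf{U}_1,\mathbf{y}_i\in\mathbf{U}_2,\mathbf{z}_i\in\mathbf{U}_3$; the zero tensor has rank $0$. *)

(* Defs.v *)
From HB Require Import structures.
From mathcomp Require Import all_boot all_order all_algebra.

Set Implicit Arguments.
Unset Strict Implicit.
Unset Printing Implicit Defensive.

Import GRing.Theory.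
Local Open Scope ring_scope.

Definition trilinear (F : fieldType) (U1 U2 U3 V : lmodType F)
    (f : U1 -> U2 -> U3 -> V) : Prop :=
  [/\ forall y z, linear (fun x => f x y z),
      forall x z, linear (fun y => f x y z)
    & forall x y, linear (fun z => f x y z)].

(* MathComp has no tensor product of vector spaces, so U1 (x) U2 (x) U3 is
   given by its universal property: [tens x y z] stands for x (x) y (x) z.
   [tensor_product_exists] below shows that such a W always exists. *)
Record is_tensor_product (F : fieldType) (U1 U2 U3 W : lmodType F)
    (tens : U1 -> U2 -> U3 -> W) : Prop := IsTensorProduct {
  tens_trilinear : trilinear tens;
  tens_factor : forall (V : lmodType F) (f : U1 -> U2 -> U3 -> V),
    trilinear f ->
    exists g : {linear W -> V}, forall x y z, g (tens x y z) = f x y z;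
  tens_unique : forall (V : lmodType F) (g h : {linear W -> V}),
    (forall x y z, g (tens x y z) = h (tens x y z)) -> g =1 h
}.

Definition is_least (P : nat -> Prop) (r : nat) : Prop :=
  P r /\ forall k, P k -> (r <= k)%N.

Definition has_decomposition (F : fieldType) (U1 U2 U3 W : lmodType F)
    (tens : U1 -> U2 -> U3 -> W) (tau : W) (k : nat) : Prop :=
  exists (x : 'I_k -> U1) (y : 'I_k -> U2) (z : 'I_k -> U3),
    tau = \sum_(i < k) tens (x i) (y i) (z i).

(* For k = 0 the sum is empty, so the zero tensor is the one of rank 0. *)
Definition is_tensor_rank (F : fieldType) (U1 U2 U3 W : lmodType F)
    (tens : U1 -> U2 -> U3 -> W) (tau : W) (r : nat) : Prop :=
  is_least (has_decomposition tens tau) r.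

(* The index set {1,2,3}; for j in it, {p,q} is the complement of {j}, with
   p = row_mode j < q = col_mode j. *)
Inductive mode := mode1 | mode2 | mode3.

Definition row_mode (j : mode) : mode :=
  match j with mode1 => mode2 | mode2 => mode1 | mode3 => mode1 end.

Definition col_mode (j : mode) : mode :=
  match j with mode1 => mode3 | mode2 => mode3 | mode3 => mode2 end.

Definition slice (F : fieldType) (m : mode -> nat)
    (t : 'I_(m mode1) -> 'I_(m mode2) -> 'I_(m mode3) -> F) (j : mode) :
    'I_(m j) -> 'M[F]_(m (row_mode j), m (col_mode j)) :=
  match j return 'I_(m j) -> 'M[F]_(m (row_mode j), m (col_mode j)) with
  | mode1 => fun i1 => \matrix_(i2, i3) t i1 i2 i3
  | mode2 => fun i2 => \matrix_(i1, i3) t i1 i2 i3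
  | mode3 => fun i3 => \matrix_(i1, i2) t i1 i2 i3
  end.
Arguments slice {F m} t j.

Definition spanned_by_rank1 (F : fieldType) (a b : nat)
    (V : {vspace 'M[F]_(a, b)}) : Prop :=
  exists X : seq 'M[F]_(a, b),
    (forall A, A \in X -> \rank A = 1%N) /\ V = <<X>>%VS.

Definition rank1_cover_dim (F : fieldType) (a b n : nat)
    (T : 'I_n -> 'M[F]_(a, b)) (d : nat) : Prop :=
  exists V : {vspace 'M[F]_(a, b)},
    [/\ spanned_by_rank1 V, (<<[seq T i | i : 'I_n]>> <= V)%VS
      & \dim V = d].

Section Existence.

Variables (F : fieldType) (U1 U2 U3 : vectType F).

Let b1 := vbasis {:U1}.
Let b2 := vbasis {:U2}.
Let b3 := vbasis {:U3}.

Let I : finType := ('I_(\dim {:U1}) * 'I_(\dim {:U2}) * 'I_(\dim {:U3}))%type.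
Let W : vectType F := {ffun I -> F^o}.

Let tens (x : U1) (y : U2) (z : U3) : W :=
  [ffun i => coord b1 i.1.1 x * coord b2 i.1.2 y * coord b3 i.2 z].

Let e (i : I) : W := tens b1`_i.1.1 b2`_i.1.2 b3`_i.2.

Let eE i j : e i j = (i == j)%:R.
Proof.
have free_b (U : vectType F) : free (vbasis {:U}).
  exact: basis_free (vbasisP _).
rewrite ffunE !coord_free // -!natrM !mulnb.
by case: i j => [[i1 i2] i3] [[j1 j2] j3]; rewrite !xpair_eqE.
Qed.

Let W_expand (w : W) : w = \sum_i (w i : F) *: e i.
Proof.
apply/ffunP => j; rewrite sum_ffunE (bigD1 j) //= big1 ?addr0.
  by rewrite ffunE eE eqxx [_ *: _]mulr1.
by move=> i /negbTE ij; rewrite ffunE eE ij scaler0.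
Qed.

Lemma tensor_product_exists :
  exists (W : vectType F) (tens : U1 -> U2 -> U3 -> W), is_tensor_product tens.
Proof.
exists W, tens; split.
- split=> [y z a x x'|x z a y y'|x y a z z']; apply/ffunP => i;
    rewrite !ffunE linearP /= -[_ *: (_ * _ * _)]/(_ * (_ * _ * _)).
  + by rewrite !mulrDl !mulrA.
  + by rewrite mulrDr mulrDl !mulrA [coord b1 _ _ * a]mulrC.
  + by rewrite mulrDr !mulrA; congr (_ * _ + _); rewrite mulrC mulrA.
- move=> V f [f1 f2 f3].
  pose g (w : W) : V := \sum_i (w i : F) *: f b1`_i.1.1 b2`_i.1.2 b3`_i.2.
  have g_lin : linear g.
    move=> a v w; rewrite /g scaler_sumr -big_split /=; apply: eq_bigr => i _.
    by rewrite !ffunE scalerDl scalerA.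
  pose gL := GRing.isLinear.Build F W V *:%R g g_lin.
  pose G : {linear W -> V} := HB.pack g gL.
  exists G => x y z.
  have lin_sum (U : vectType F) (h : U -> V) : linear h -> forall x : U,
      h x = \sum_(i < \dim {:U}) coord (vbasis {:U}) i x *: h (vbasis {:U})`_i.
    move=> h_lin v.
    pose hL := GRing.isLinear.Build F U V *:%R h h_lin.
    pose H : {linear U -> V} := HB.pack h hL.
    rewrite {1}(coord_vbasis (memvf v)) -[h]/(H : U -> V) linear_sum.
    by apply: eq_bigr => i _; rewrite linearZ.
  transitivity (\sum_i \sum_j \sum_k
      tens x y z (i, j, k) *: f b1`_i b2`_j b3`_k).
    by rewrite pair_bigA /= pair_bigA; apply: eq_bigr => -[[i j] k].
  rewrite (lin_sum _ _ (f1 y z)); symmetry.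
  apply: eq_bigr => i _; rewrite (lin_sum _ _ (f2 _ z)) scaler_sumr.
  apply: eq_bigr => j _; rewrite (lin_sum _ _ (f3 _ _)) !scaler_sumr.
  by apply: eq_bigr => k _; rewrite ffunE /= !scalerA.
- move=> V g h gh w; rewrite (W_expand w) !linear_sum.
  by apply: eq_bigr => i _; rewrite !linearZ /= gh.
Qed.

End Existence.

(* Main.v *)
Require Import Defs.
From mathcomp Require Import all_boot all_order all_algebra.
From HB Require Import structures.
From Stdlib Require Import Classical_Prop.

Set Implicit Arguments.
Unset Strict Implicit.
Unset Printing Implicit Defensive.

Import GRing.Theory.
Local Open Scope ring_scope.

(** Over a field F, a decomposition of tau into k simple tensors is the same
    thing as a way of writing the coordinate array
    t_(i1,i2,i3) = sum_l x_l(i1) y_l(i2) z_l(i3).  Singling out one index j and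
    reading the other two as row and column, this equation says that every slice
    T_(i,j) is a linear combination of the same k outer products, that is, lies
    in the span of k matrices of rank at most one.

    So a decomposition with k terms gives a covering space of dimension at most
    k: keep the outer products that are not zero and take their span
    ([array_decomposition_cover]).  Conversely, a covering space of dimension d
    that is spanned by rank one matrices has a basis made of d of them, and the
    coordinates of the slices in this basis give a decomposition with exactly d
    terms ([cover_array_decomposition]).  Both minima therefore agree.

    The passage between tau and its array ([has_decompositionP]) needs from the
    tensor product that simple tensors expand by trilinearity, and that the
    coordinates are well defined on it: the product of one coordinate form on
    each factor is trilinear, hence factors through a linear form on W. *)

(** * Least elements *)

Lemma exists_is_least (P : nat -> Prop) n : P n -> exists r, is_least P r.
Proof.
elim/ltn_ind: n => n IHn Pn.
have [[k ltkn Pk] | minn] := classic (exists2 k, (k < n)%N & P k).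
  exact: IHn Pk.
exists n; split=> // k Pk; rewrite leqNgt; apply/negP => ltkn.
by apply: minn; exists k.
Qed.

(** One may pad a decomposition to any larger number of terms, whereas the
    dimension of a covering space is bounded by that of the matrix space: the
    two predicates are not equivalent, so they are compared by an implication
    in one direction and up to decreasing the number in the other. *)
Lemma is_least_transfer (P Q : nat -> Prop) r :
    (forall d, Q d -> P d) ->
    (forall k, P k -> exists2 d, (d <= k)%N & Q d) ->
  is_least Q r -> is_least P r.
Proof.
move=> QP PQ [Qr minr]; split=> [|k /PQ[d ledk Qd]]; first exact: QP.
exact: leq_trans (minr d Qd) ledk.
Qed.

(** * Decompositions of coordinate arrays *)

Definition array_decomposition (F : fieldType) (n1 n2 n3 : nat)
    (t : 'I_n1 -> 'I_n2 -> 'I_n3 -> F) (k : nat) : Prop :=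
  exists (x : 'I_k -> 'I_n1 -> F) (y : 'I_k -> 'I_n2 -> F)
         (z : 'I_k -> 'I_n3 -> F),
    forall i1 i2 i3, t i1 i2 i3 = \sum_(l < k) x l i1 * y l i2 * z l i3.

(** The condition treats the three indices alike, so it does not matter which of
    them is chosen to index the slices. *)
Lemma array_decomposition_slice (F : fieldType) (m : mode -> nat)
    (t : 'I_(m mode1) -> 'I_(m mode2) -> 'I_(m mode3) -> F) (j : mode) k :
  array_decomposition t k <->
  array_decomposition (fun i p q => slice t j i p q) k.
Proof.
case: j => /=; split=> -[x [y [z txyz]]].
- by exists x, y, z => i p q; rewrite mxE txyz.
- by exists x, y, z => i p q; rewrite -txyz mxE.
- exists y, x, z => i p q; rewrite mxE txyz.
  by apply: eq_bigr => l _; rewrite [x l _ * _]mulrC.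
- exists y, x, z => i p q; have:= txyz p i q; rewrite mxE => ->.
  by apply: eq_bigr => l _; rewrite [x l _ * _]mulrC.
- exists z, x, y => i p q; rewrite mxE txyz.
  by apply: eq_bigr => l _; rewrite mulrC mulrA.
- exists y, z, x => i p q; have:= txyz q i p; rewrite mxE => ->.
  by apply: eq_bigr => l _; rewrite -mulrA mulrC.
Qed.

(** * Slices and spaces spanned by rank one matrices *)

Lemma spanning_seq_basis (K : fieldType) (vT : vectType K) (X : seq vT) :
  exists2 Y : seq vT, {subset Y <= X} & basis_of <<X>> Y.
Proof.
elim: X => [|v X [Y sYX basY]].
  by exists [::]; rewrite // span_nil nil_basis.
have [spanY freeY] := (span_basis basY, basis_free basY).
have [vX | vX] := boolP (v \in <<X>>%VS).
  exists Y => [w /sYX wX|]; first by rewrite inE wX orbT.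
  suff -> : <<v :: X>>%VS = <<X>>%VS by [].
  by rewrite span_cons; apply/addv_idPr; rewrite -memvE.
exists (v :: Y) => [w|].
  by rewrite !inE => /orP[-> // | /sYX ->]; rewrite orbT.
by rewrite /basis_of free_cons spanY vX freeY !span_cons spanY eqxx.
Qed.

Lemma rank1_outer (F : fieldType) a b (A : 'M[F]_(a, b)) :
  \rank A = 1%N -> exists (x : 'I_a -> F) (y : 'I_b -> F),
    forall p q, A p q = x p * y q.
Proof.
move=> rA; have := mulmx_base A; move: (col_base A) (row_base A).
rewrite rA => C R CR; exists (C^~ 0), (R 0) => p q.
by rewrite -{1}CR mxE big_ord1.
Qed.

(** The basis has to be extracted from the rank one generators: each of its d
    elements then contributes a single term, whereas an arbitrary basis of the
    covering space could need more. *)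
Lemma cover_array_decomposition (F : fieldType) a b n
    (T : 'I_n -> 'M[F]_(a, b)) d :
  rank1_cover_dim T d -> array_decomposition (fun i p q => T i p q) d.
Proof.
case=> V [[X [rankX ->]] /span_subvP TX <-].
have [Y sYX basY] := spanning_seq_basis X.
have sizeY : size Y == \dim <<X>> by rewrite (size_basis (X := in_tuple Y)).
pose B := Tuple sizeY.
have outerB (l : 'I_(\dim <<X>>)) : exists xy : ('I_a -> F) * ('I_b -> F),
    forall p q, B`_l p q = xy.1 p * xy.2 q.
  have [|x [y Bxy]] := @rank1_outer F a b B`_l; last by exists (x, y).
  by apply/rankX/sYX/mem_nth; rewrite (eqP sizeY).
have [xy Bxy] := fin_all_exists outerB.
exists (fun l i => coord B l (T i)), (fun l => (xy l).1), (fun l => (xy l).2).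
move=> i p q.
have TiX : T i \in <<X>>%VS by apply/TX/map_f; rewrite mem_enum.
rewrite {1}(coord_basis (X := B) basY TiX) summxE; apply: eq_bigr => l _.
by rewrite mxE Bxy mulrA.
Qed.

(** The dimension can drop below k, since the k outer products may be dependent
    and some of them may vanish. *)
Lemma array_decomposition_cover (F : fieldType) a b n
    (T : 'I_n -> 'M[F]_(a, b)) k :
  array_decomposition (fun i p q => T i p q) k ->
  exists2 d, (d <= k)%N & rank1_cover_dim T d.
Proof.
case=> c [x [y Txy]].
pose E l : 'M[F]_(a, b) := (\col_p x l p) *m (\row_q y l q).
(* A zero outer product has rank 0 and is no admissible generator. *)
pose X := [seq A <- [seq E l | l : 'I_k] | \rank A == 1%N].
have EX l : E l \in <<X>>%VS.
  have: (\rank (E l) <= 1)%N := mulmx_max_rank _ _.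
  rewrite leq_eqVlt ltnS leqn0 mxrank_eq0 => /orP[rE | /eqP->].
    by apply: memv_span; rewrite mem_filter rE map_f ?mem_enum.
  exact: mem0v.
exists (\dim <<X>>).
  apply: leq_trans (dim_span X) _; rewrite size_filter.
  by apply: leq_trans (count_size _ _) _; rewrite size_map size_enum_ord.
exists <<X>>%VS; split=> //.
  by exists X; split=> // A; rewrite mem_filter => /andP[/eqP].
apply/span_subvP => _ /mapP[i _ ->].
suff -> : T i = \sum_l c l i *: E l by apply: memv_suml => l _; exact/memvZ/EX.
apply/matrixP => p q; rewrite Txy summxE; apply: eq_bigr => l _.
by rewrite !mxE big_ord1 !mxE mulrA.
Qed.

(** The elementary matrices have rank one and span the whole space, which covers
    any family of slices. *)
Lemma exists_rank1_cover (F : fieldType) a b n (T : 'I_n -> 'M[F]_(a, b)) :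
  exists d, rank1_cover_dim T d.
Proof.
exists (\dim {:'M[F]_(a, b)}), fullv; split; rewrite ?subvf //.
exists [seq delta_mx ij.1 ij.2 | ij : 'I_a * 'I_b]; split.
  by move=> _ /mapP[ij _ ->]; exact: mxrank_delta.
apply/eqP; rewrite eq_sym eqEsubv subvf; apply/subvP => A _.
rewrite (matrix_sum_delta A); apply: memv_suml => p _; apply: memv_suml => q _.
by apply/memvZ/memv_span/mapP; exists (p, q); rewrite // mem_enum.
Qed.

(** * Decompositions of a tensor in coordinates *)

Lemma linear_sumZ (F : fieldType) (U V : lmodType F) (f : U -> V) n
    (a : 'I_n -> F) (v : 'I_n -> U) :
  linear f -> f (\sum_i a i *: v i) = \sum_i a i *: f (v i).
Proof.
move=> f_lin; pose fL : {linear U -> V} :=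
  HB.pack f (GRing.isLinear.Build F U V *:%R f f_lin).
rewrite -[f]/(fL : U -> V) linear_sum; apply: eq_bigr => i _.
by rewrite linearZ.
Qed.

Lemma trilinear_expand (F : fieldType) (U1 U2 U3 V : lmodType F)
    (f : U1 -> U2 -> U3 -> V) n1 n2 n3 (a : 'I_n1 -> F) (b : 'I_n2 -> F)
    (c : 'I_n3 -> F) (u : 'I_n1 -> U1) (v : 'I_n2 -> U2) (w : 'I_n3 -> U3) :
  trilinear f ->
  f (\sum_i a i *: u i) (\sum_i b i *: v i) (\sum_i c i *: w i) =
  \sum_i1 \sum_i2 \sum_i3 (a i1 * b i2 * c i3) *: f (u i1) (v i2) (w i3).
Proof.
case=> f1 f2 f3; rewrite (linear_sumZ _ _ (f1 _ _)); apply: eq_bigr => i1 _.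
rewrite (linear_sumZ _ _ (f2 _ _)) scaler_sumr; apply: eq_bigr => i2 _.
rewrite (linear_sumZ _ _ (f3 _ _)) !scaler_sumr; apply: eq_bigr => i3 _.
by rewrite !scalerA.
Qed.

Lemma trilinear_mul_forms (F : fieldType) (U1 U2 U3 : lmodType F)
    (f1 : {scalar U1}) (f2 : {scalar U2}) (f3 : {scalar U3}) :
  trilinear (fun x y z => f1 x * f2 y * f3 z : F^o).
Proof.
split=> [y z a x x'|x z a y y'|x y a z z']; rewrite linearP /=
  -[X in _ = X + _]/(a * (_ * _ * _)).
- by rewrite !mulrDl !mulrA.
- by rewrite mulrDr mulrDl !mulrA [f1 x * a]mulrC.
- by rewrite mulrDr !mulrA [f1 x * f2 y * a]mulrC !mulrA.
Qed.

Lemma sum_mul_delta (F : fieldType) n (i : 'I_n) (f : 'I_n -> F) :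
  \sum_j f j * (j == i)%:R = f i.
Proof.
rewrite (bigD1 i) //= eqxx mulr1 big1 ?addr0 // => j /negbTE ->.
by rewrite mulr0.
Qed.

(** Coordinates on the tensor product are well defined: the product of the three
    coordinate forms is trilinear, hence factors through a linear form, and that
    form kills all products of members of the three families but one. *)
Lemma tensor_entry (F : fieldType) (U1 U2 U3 : vectType F) (W : lmodType F)
    (tens : U1 -> U2 -> U3 -> W) n1 n2 n3
    (u1 : n1.-tuple U1) (u2 : n2.-tuple U2) (u3 : n3.-tuple U3) i1 i2 i3 :
    is_tensor_product tens -> free u1 -> free u2 -> free u3 ->
  exists g : {linear W -> F^o},
    forall a : 'I_n1 -> 'I_n2 -> 'I_n3 -> F,
      g (\sum_j1 \sum_j2 \sum_j3
           a j1 j2 j3 *: tens (tnth u1 j1) (tnth u2 j2) (tnth u3 j3)) =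
      a i1 i2 i3.
Proof.
move=> [_ factor _] free1 free2 free3.
have [g gE] := factor _ _
  (trilinear_mul_forms (coord u1 i1 : {scalar U1}) (coord u2 i2 : {scalar U2})
    (coord u3 i3 : {scalar U3})).
exists g => a; rewrite linear_sum -(sum_mul_delta i1 (fun j => a j i2 i3)).
apply: eq_bigr => j1 _.
rewrite linear_sum -(sum_mul_delta i2 (fun j => a j1 j i3)) mulr_suml.
apply: eq_bigr => j2 _.
rewrite linear_sum -(sum_mul_delta i3 (a j1 j2)) !mulr_suml.
apply: eq_bigr => j3 _.
rewrite linearZ /= gE /= !(tnth_nth 0) !coord_free // -[LHS]/(_ * (_ * _ * _)).
rewrite -!mulrA; congr (_ * _).
by rewrite mulrA mulrC [(j1 == i1)%:R * _]mulrC.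
Qed.

Lemma sum_tens_expand (F : fieldType) (U1 U2 U3 W : lmodType F)
    (tens : U1 -> U2 -> U3 -> W) k n1 n2 n3 (u1 : 'I_n1 -> U1)
    (u2 : 'I_n2 -> U2) (u3 : 'I_n3 -> U3) (x : 'I_k -> 'I_n1 -> F)
    (y : 'I_k -> 'I_n2 -> F) (z : 'I_k -> 'I_n3 -> F) :
  trilinear tens ->
  \sum_(l < k) tens (\sum_i x l i *: u1 i) (\sum_i y l i *: u2 i)
                    (\sum_i z l i *: u3 i) =
  \sum_i1 \sum_i2 \sum_i3
    (\sum_(l < k) x l i1 * y l i2 * z l i3) *: tens (u1 i1) (u2 i2) (u3 i3).
Proof.
move=> tri; under eq_bigr do rewrite trilinear_expand //.
rewrite exchange_big; apply: eq_bigr => i1 _.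
rewrite exchange_big; apply: eq_bigr => i2 _.
rewrite exchange_big; apply: eq_bigr => i3 _.
by rewrite scaler_suml.
Qed.

(** The converse is trilinearity alone; the direct implication compares two
    expansions of the same tensor entry by entry. *)
Lemma has_decompositionP (F : fieldType) (U1 U2 U3 : vectType F)
    (W : lmodType F) (tens : U1 -> U2 -> U3 -> W) n1 n2 n3
    (u1 : n1.-tuple U1) (u2 : n2.-tuple U2) (u3 : n3.-tuple U3)
    (t : 'I_n1 -> 'I_n2 -> 'I_n3 -> F) k :
    is_tensor_product tens -> basis_of fullv u1 -> basis_of fullv u2 ->
    basis_of fullv u3 ->
  has_decomposition tens
    (\sum_i1 \sum_i2 \sum_i3
       t i1 i2 i3 *: tens (tnth u1 i1) (tnth u2 i2) (tnth u3 i3)) k <->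
  array_decomposition t k.
Proof.
move=> htens bas1 bas2 bas3; have tri := tens_trilinear htens.
split=> [[x [y [z tauE]]] | [x [y [z txyz]]]]; last first.
  exists (fun l => \sum_i x l i *: tnth u1 i),
    (fun l => \sum_i y l i *: tnth u2 i),
    (fun l => \sum_i z l i *: tnth u3 i).
  rewrite sum_tens_expand //.
  by do 3![apply: eq_bigr => ? _]; rewrite txyz.
exists (fun l i => coord u1 i (x l)), (fun l i => coord u2 i (y l)),
  (fun l i => coord u3 i (z l)) => i1 i2 i3.
have expand n (U : vectType F) (b : n.-tuple U) v : basis_of fullv b ->
    v = \sum_i coord b i v *: tnth b i.
  move=> basb; rewrite {1}(coord_basis basb (memvf v)).
  by apply: eq_bigr => i _; rewrite (tnth_nth 0).
have [g gE] := tensor_entry i1 i2 i3 htens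
  (basis_free bas1) (basis_free bas2) (basis_free bas3).
rewrite -(gE t) tauE -(gE (fun i1 i2 i3 => \sum_(l < k) _ * _ * _)).
rewrite -sum_tens_expand //; congr (g _); apply: eq_bigr => l _.
by rewrite -!expand.
Qed.

Theorem theorem2p4 (F : fieldType) (U : mode -> vectType F) (m : mode -> nat)
    (hdim : forall i, \dim {: U i} = m i)
    (u : forall i, (m i).-tuple (U i))
    (hu : forall i, basis_of {: U i} (u i))
    (W : lmodType F) (tens : U mode1 -> U mode2 -> U mode3 -> W)
    (htens : is_tensor_product tens)
    (t : 'I_(m mode1) -> 'I_(m mode2) -> 'I_(m mode3) -> F)
    (tau : W)
    (htau : tau = \sum_(i1 < m mode1) \sum_(i2 < m mode2) \sum_(i3 < m mode3)
       t i1 i2 i3 *: tens (tnth (u mode1) i1) (tnth (u mode2) i2)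
                          (tnth (u mode3) i3))
    (j : mode) :
  exists r : nat,
    is_tensor_rank tens tau r /\ is_least (rank1_cover_dim (slice t j)) r.
Proof.
have [d0 cover0] := exists_rank1_cover (slice t j).
have [r leastr] := exists_is_least cover0.
exists r; split=> //; move: leastr; rewrite htau.
have decP k := has_decompositionP t k htens (hu mode1) (hu mode2) (hu mode3).
apply: is_least_transfer => [d | k].
  by move=> /cover_array_decomposition/(array_decomposition_slice t j)/decP.
by move/decP/(array_decomposition_slice t j)/array_decomposition_cover.
Qed.
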